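(* Consider the problem $$(\mathbf{P2})\qquad \max_{u\in\mathcal U}\ J(u),\qquad J(u)=\inf_{\mathbb Q\in\mathbb B_{\epsilon(\beta)}(\hat{\mathbb P}(u))}\mathbb E_{\mathbb Q}[H(u;\rho)],$$ and the problem $$(\mathbf{P3})\qquad \max_{u,\rho,\lambda,\mu,\nu,\eta}\ -\lambda\,\epsilon(\beta)-\frac1N\sum_{e,t,l}\overline f_e\,\overline\rho_e\,\eta^{(l)}_e(t)+\frac1N\sum_{l}\langle\nu^{(l)},\rho^{(l)}\rangle$$ subject to, for all $e\in\{1,\dots,n\}$, $t\in\{1,\dots,T\}$, $l\in\mathcal L$, $$\left[\overline f_e+u_e\left(\overline\rho_e-\rho^c_e(\overline u_e)\right)\right]\eta^{(l)}_e(t)-\mu^{(l)}_e(t)\ge 0,\qquad \nu^{(l)}_e(t)=\mu^{(l)}_e(t)+\tfrac1T u_e,$$ $$\|\nu^{(l)}\|_\star\le\lambda,\qquad \eta^{(l)}_e(t)\ge 0,\qquad u\in\mathcal U,$$ and $\rho^{(l)}$ is the sample trajectory generated from $\varpi^{(l)}$ under the speed limits $u$, where $\lambda\in\mathbb R$ and $\mu^{(l)},\nu^{(l)},\eta^{(l)}\in\mathbb R^{nT}$. (i) $(\mathbf{P2})$ is equivalent to $(\mathbf{P3})$ in the sense that their optimal objective values are the same and the set of optimizers of $(\mathbf{P2})$ is the projection (onto the $u$-component) of the set of optimizers of $(\mathbf{P3})$. (ii) For any feasible point $(u,\rho,\lambda,\mu,\nu,\eta)$ of $(\mathbf{P3})$,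 let $\hat J(u)$ denote the value of its objective function. Then the pair $(u,\hat J(u))$ gives a data-driven solution $u$ with an estimate $\hat J(u)$ of its certificate $J(u)$ such that the performance guarantee $$P^N\left(\mathbb E_{\mathbb P(u)}[H(u;\rho)]\ge\hat J(u)\right)\ge 1-\beta$$ holds. (Here, for a given $u\in\mathcal U$, the remaining components of the feasible point may depend measurably on the samples.)
   Context: **Highway model.** A one-way highway of length $L$ is divided into $n$ equal segments, modeled as the edges $e=1,\dots,n$ of a chain; the edge preceding $e$ is $e-1$, and edge $1$ has no preceding edge. Time slots are $\mathcal T=\{0,1,\dots,T\}$, each of duration $\delta$. For each edge $e$, $\overline u_e,\overline\rho_e,\overline f_e>0$ are the maximal free-flow speed, jam density and capacity, with $\overline f_e<\overline u_e\overline\rho_e$. Let $h=n\delta/L$, with $0<h\le1/\max_e\overline u_e$. The admissible speed-limit vectors are $$\mathcal U=\{u=(u_1,\dots,u_n): u_e\in\Gamma,\ u_e^{\mathrm L}\le u_e\le u_e^{\mathrm U}\ \forall e\},$$ where $\Gamma=\{\gamma^{(1)},\dots,\gamma^{(m)}\}$ is a finite set of positive speed limits and $u_e^{\mathrm L},u_e^{\mathrm U}$ are given bounds. **Critical density.** $\rho^c_e(u_e)=\dfrac{\tau_e\overline\rho_e\overline u_e}{\tau_e\overline u_e+u_e}$ with $\tau_e=\dfrac{\overline f_e}{\overline u_e\overline\rho_e-\overline f_e}$; in particular $\rho^c_e(\overline u_e)=\overline f_e/\overline u_e$. **Uncertainty, trajectories, samples.** $\varpi=(\rho(0),\omega)$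 collects the random initial density $\rho(0)=(\rho_e(0))_e$ and the random net inflows $\omega=(\omega_e(t))_{e,\,t\in\mathcal T}$; its unknown distribution $\mathbb P_\varpi$ does not depend on $u$ and is light-tailed: there is $a>1$ with $\mathbb E_{\mathbb P_\varpi}[\exp(\|\varpi\|^a)]<\infty$. For given $u$, the trajectory $\rho=(\rho_e(t))_{e\in\{1,\dots,n\},\,t\in\{1,\dots,T\}}\in\mathbb R^{nT}$ is defined by $$\rho_e(t+1)=\rho_e(t)+h\left(u_{e-1}\rho_{e-1}(t)-u_e\rho_e(t)+\omega_e(t)\right),\qquad t\in\{0,\dots,T-1\},$$ with the term indexed by $e-1$ absent when $e=1$; $\mathbb P(u)$ is the law of $\rho$ induced by $\mathbb P_\varpi$. Given iid samples $\varpi^{(l)}=(\rho^{(l)}(0),\omega^{(l)})$, $l\in\mathcal L=\{1,\dots,N\}$, of $\varpi$, the sample trajectory $\rho^{(l)}\in\mathbb R^{nT}$ under $u$ is obtained from the same recursion with $\varpi^{(l)}$ in place of $\varpi$; it is uniquely determined by $u$ and $\varpi^{(l)}$. $P^N$ denotes probability with respect to the $N$ iid samples. **Support.** $\mathcal Z(u)=\{\rho\in\mathbb R^{nT}: 0\le\rho_e(t)\le\rho^c_e(u_e)\ \forall e,t\}$. Standing assumption: for each $u\in\mathcal U$, $\mathbb P(u)$ is supported on $\mathcal Z(u)$, and correspondingly the sample trajectories under $u$ lie in $\mathcal Z(u)$. **Objective and ambiguity set.** $H(u;\rho)=\frac1T\sum_{e=1}^n\sum_{t=1}^T\rho_e(t)u_e$.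 $\|\cdot\|$ is the $1$-norm on $\mathbb R^{nT}$ and $\|x\|_\star=\sup_{\|z\|\le1}\langle z,x\rangle$ its dual norm. $\hat{\mathbb P}(u)=\frac1N\sum_{l\in\mathcal L}\delta_{\rho^{(l)}}$ is the empirical distribution of the sample trajectories under $u$. $\mathbb B_\epsilon(\hat{\mathbb P}(u))$ is the set of probability distributions supported on $\mathcal Z(u)$ whose $1$-Wasserstein distance (with ground cost $\|\cdot\|$) to $\hat{\mathbb P}(u)$ is at most $\epsilon$. For the given $\beta\in(0,1)$, the radius $\epsilon(\beta)>0$ is chosen (via measure concentration for light-tailed distributions) so that $P^N\left(\mathbb P(u)\in\mathbb B_{\epsilon(\beta)}(\hat{\mathbb P}(u))\right)\ge1-\beta$ for every $u\in\mathcal U$. $J(u)$ is called the certificate of $u$. Sums over $e,t,l$ range over $e\in\{1,\dots,n\}$, $t\in\{1,\dots,T\}$, $l\in\mathcal L$. *)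

(* Defs.v *)
From HB Require Import structures.
From mathcomp Require Import all_boot all_order all_algebra.
From mathcomp Require Import all_classical all_reals all_analysis.
From mathcomp Require Import measurable_realfun.
Set Implicit Arguments.
Unset Strict Implicit.
Unset Printing Implicit Defensive.
Set Warnings "-redundant-canonical-projection".
Import Order.TTheory GRing.Theory Num.Theory.
Import numFieldNormedType.Exports.
Local Open Scope classical_set_scope.
Local Open Scope ring_scope.

(* The sigma-algebra on 'M[R]_(p, q) is the one generated by the coordinates,
   i.e. the Borel sigma-algebra of R^(p * q). *)

Definition measure_matrix_display : measure_display -> measure_display.
Proof. exact. Qed.

Section measurable_matrix.
Context {R : realType} (p q : nat).

Definition coord_sets : set (set 'M[R]_(p, q)) :=
  [set A | exists i j (B : set R),
     measurable B /\ A = [set x : 'M[R]_(p, q) | B (x i j)]].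

Let matrix_set0 : <<s coord_sets >> set0.
Proof. exact: sigma_algebra0. Qed.

Let matrix_setC A : <<s coord_sets >> A -> <<s coord_sets >> (~` A).
Proof. exact: sigma_algebraC. Qed.

Let matrix_bigcup (F : (set 'M[R]_(p, q))^nat) :
  (forall k, <<s coord_sets >> (F k)) -> <<s coord_sets >> (\bigcup_k F k).
Proof. exact: sigma_algebra_bigcup. Qed.

HB.instance Definition _ :=
  @isMeasurable.Build (measure_matrix_display default_measure_display)
    'M[R]_(p, q) <<s coord_sets >> matrix_set0 matrix_setC matrix_bigcup.

Lemma measurable_coord i j :
  measurable_fun [set: 'M[R]_(p, q)] (fun x : 'M[R]_(p, q) => x i j).
Proof.
move=> _ B mB; rewrite setTI; apply: sub_sigma_algebra.
by exists i, j, B.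
Qed.

Lemma measurable_mxP d (S : measurableType d) (f : S -> 'M[R]_(p, q)) :
  measurable_fun [set: S] f <->
  forall i j, measurable_fun [set: S] (fun s => f s i j).
Proof.
split=> [mf i j|mf].
  exact: (measurableT_comp (measurable_coord i j) mf).
apply: (@measurability _ _ _ _ _ _ coord_sets) => //.
move=> _ [_ [i [j [B [mB ->]]]] <-].
exact: (mf i j).
Qed.

End measurable_matrix.

Section vectors.
Context {R : realType} {p q : nat}.
Implicit Types x z : 'M[R]_(p, q).

Definition inner z x : R := \sum_i \sum_j z i j * x i j.

(* The norm `|x| of matrices in the library is the max norm. *)
Definition norm1 x : R := \sum_i \sum_j `|x i j|.

Definition dual_norm x : R := sup [set inner z x | z in [set z | norm1 z <= 1]].

End vectors.

Section wasserstein.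
Context {R : realType} {p q : nat}.
Local Notation X := 'M[R]_(p, q).

Definition couplings (mu nu : {measure set X -> \bar R}) :
    set (probability (X * X)%type R) :=
  [set pi | forall A : set X, measurable A ->
     pi (A `*` setT) = mu A /\ pi (setT `*` A) = nu A].

Definition wasserstein1 (mu nu : {measure set X -> \bar R}) : \bar R :=
  ereal_inf [set \int[pi]_z (norm1 (z.1 - z.2))%:E | pi in couplings mu nu]%E.

Definition empirical (N : nat) (rho : N.-tuple X) : {measure set X -> \bar R} :=
  mscale (N%:R^-1)%:nng (msum (fun l => \d_(rho`_l)) N).

End wasserstein.

(* Edge e of the chain is the ordinal e.-1 : 'I_n. *)
Record highway (R : realType) (n m : nat) := Highway {
  len : R;
  slot : R;
  ubar : 'cV[R]_n;
  rhobar : 'cV[R]_n;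
  fbar : 'cV[R]_n;
  gamma : m.-tuple R;
  uL : 'cV[R]_n;
  uU : 'cV[R]_n }.

Section model.
Context {R : realType} {n m : nat} (hw : highway R n m).
Local Notation ubar e := (ubar hw e 0).
Local Notation rhobar e := (rhobar hw e 0).
Local Notation fbar e := (fbar hw e 0).

Definition step : R := n%:R * slot hw / len hw.

Record well_posed : Prop := WellPosed {
  len_gt0 : 0 < len hw;
  slot_gt0 : 0 < slot hw;
  ubar_gt0 : forall e, 0 < ubar e;
  rhobar_gt0 : forall e, 0 < rhobar e;
  fbar_gt0 : forall e, 0 < fbar e;
  fbar_lt : forall e, fbar e < ubar e * rhobar e;
  step_gt0 : 0 < step;
  step_le : step <= 1 / \big[Num.max/0]_(e < n) ubar e;
  gamma_gt0 : forall k, 0 < tnth (gamma hw) k }.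

Definition admissible : set 'cV[R]_n :=
  [set u | forall e, u e 0 \in gamma hw /\ uL hw e 0 <= u e 0 <= uU hw e 0].

Definition tau (e : 'I_n) : R := fbar e / (ubar e * rhobar e - fbar e).

Definition rhoc (e : 'I_n) (v : R) : R :=
  tau e * rhobar e * ubar e / (tau e * ubar e + v).

Variable T : nat.

(* Initial density, and net inflows omega_e(t) at column t = 0, ..., T. *)
Definition uncertainty := ('cV[R]_n * 'M[R]_(n, T.+1))%type.

(* Column t of a trajectory holds the densities rho_e(t.+1), 1 <= t.+1 <= T. *)
Definition trajectory := 'M[R]_(n, T).

(* u_{e-1} rho_{e-1}: the sum has one term, or none if e is the first edge. *)
Definition upstream (u r : 'cV[R]_n) (e : 'I_n) : R :=
  \sum_(i < n | i.+1 == e :> nat) u i 0 * r i 0.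

Fixpoint density (u : 'cV[R]_n) (w : uncertainty) (t : nat) : 'cV[R]_n :=
  if t is s.+1 then
    let r := density u w s in
    \col_e (r e 0 + step * (upstream u r e - u e 0 * r e 0 + w.2 e (inord s)))
  else w.1.

Definition traj (u : 'cV[R]_n) (w : uncertainty) : trajectory :=
  \matrix_(e, t) density u w t.+1 e 0.

Lemma measurable_density u t e :
  measurable_fun [set: uncertainty] (fun w => density u w t e 0).
Proof.
elim: t e => [|t IH] e /=.
  exact: (measurableT_comp (measurable_coord e 0) measurable_fst).
have mw : measurable_fun [set: uncertainty]
    (fun w : uncertainty => w.2 e (inord t)).
  exact: (measurableT_comp (measurable_coord e (inord t)) measurable_snd).
have mup : measurable_fun [set: uncertainty]
    (fun w => upstream u (density u w t) e).
  rewrite /upstream.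
  under eq_fun => w do rewrite -big_filter.
  by apply: measurable_sum => i; apply: measurable_funM => //; exact: IH.
under eq_fun do rewrite mxE.
apply: measurable_funD; first exact: IH.
apply: measurable_funM => //; apply: measurable_funD => //.
by apply: measurable_funB => //; apply: measurable_funM => //; exact: IH.
Qed.

Lemma measurable_traj u : measurable_fun [set: uncertainty] (traj u).
Proof.
apply/measurable_mxP => e t.
under eq_fun do rewrite mxE.
exact: measurable_density.
Qed.

HB.instance Definition _ u :=
  isMeasurableFun.Build _ _ _ _ (traj u) (measurable_traj u).

Definition traj_law (Pw : probability uncertainty R) (u : 'cV[R]_n) :
  probability trajectory R := distribution Pw (traj u).

Definition traj_support (u : 'cV[R]_n) : set trajectory :=
  [set rho | forall e t, 0 <= rho e t <= rhoc e (u e 0)].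

Definition flow (u : 'cV[R]_n) (rho : trajectory) : R :=
  T%:R^-1 * \sum_e \sum_t rho e t * u e 0.

(* The norm on the space of uncertainties is immaterial: all norms give the
   same light-tailed distributions. *)
Definition light_tailed (Pw : probability uncertainty R) : Prop :=
  exists2 a : R, 1 < a &
    (\int[Pw]_w (expR ((norm1 w.1 + norm1 w.2) `^ a))%:E < +oo)%E.

Variable N : nat.

Definition samples := N.-tuple uncertainty.

(* PN is the law of N independent draws from Pw: the N-fold product measure. *)
Definition iid_law (Pw : probability uncertainty R)
    (PN : probability samples R) : Prop :=
  forall A : 'I_N -> set uncertainty, (forall l, measurable (A l)) ->
    PN [set x | forall l, A l (tnth x l)] = (\prod_(l < N) Pw (A l))%E.

Definition sample_trajs (u : 'cV[R]_n) (x : samples) : N.-tuple trajectory :=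
  [tuple traj u (tnth x l) | l < N].

Definition ambiguity_ball (eps : R) (u : 'cV[R]_n) (x : samples) :
    set (probability trajectory R) :=
  [set Q : probability trajectory R | Q (traj_support u) = 1%E /\
     (wasserstein1 Q (empirical (sample_trajs u x)) <= eps%:E)%E].

Definition certificate (eps : R) (x : samples) (u : 'cV[R]_n) : \bar R :=
  ereal_inf [set 'E_Q[flow u] | Q in ambiguity_ball eps u x]%E.

(* A point (u, rho, lambda, mu, nu, eta). *)
Definition p3_point : Type :=
  ('cV[R]_n * N.-tuple trajectory * R *
   N.-tuple trajectory * N.-tuple trajectory * N.-tuple trajectory)%type.

Definition p3_u (p : p3_point) : 'cV[R]_n :=
  let: (u, _, _, _, _, _) := p in u.

Definition p3_feasible (x : samples) : set p3_point :=
  [set p : p3_point | let: (u, rho, lam, mu, nu, eta) := p in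
    [/\ forall e t l,
          0 <= (fbar e + u e 0 * (rhobar e - rhoc e (ubar e)))
               * tnth eta l e t - tnth mu l e t,
        forall e t l, tnth nu l e t = tnth mu l e t + T%:R^-1 * u e 0,
        forall l, dual_norm (tnth nu l) <= lam,
        forall e t l, 0 <= tnth eta l e t &
        admissible u /\ rho = sample_trajs u x]].

Definition p3_objective (eps : R) (p : p3_point) : R :=
  let: (u, rho, lam, mu, nu, eta) := p in
  - lam * eps
  - N%:R^-1 * (\sum_e \sum_t \sum_l fbar e * rhobar e * tnth eta l e t)
  + N%:R^-1 * \sum_l inner (tnth nu l) (tnth rho l).

End model.

Arguments uncertainty R n T : clear implicits.
Arguments trajectory R n T : clear implicits.
Arguments samples R n T N : clear implicits.
Arguments p3_point R n T N : clear implicits.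

Section maximization.
Context {R : realType} {X : Type} (S : set X) (f : X -> \bar R).

Definition max_value : \bar R := ereal_sup (f @` S).

Definition maximizers : set X := [set x | S x /\ forall y, S y -> (f y <= f x)%E].

End maximization.

(* Main.v *)
Require Import Defs.
From HB Require Import structures.
From mathcomp Require Import all_boot all_order all_algebra.
From mathcomp Require Import all_classical all_reals all_analysis.
From mathcomp Require Import measurable_realfun ring lra.
Set Implicit Arguments.
Unset Strict Implicit.
Unset Printing Implicit Defensive.
Import Order.TTheory GRing.Theory Num.Theory.
Import numFieldNormedType.Exports.
Local Open Scope classical_set_scope.
Local Open Scope ring_scope.

(** The certificate of u is the worst expected flow over a Wasserstein ball, a
    linear program over probability measures, and the second problem is its
    dual. For fixed u the two values are shown to be equal.

    Weak duality (weak_duality): a feasible point provides vectors nu^(l) whose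
    entries are at most lambda in absolute value, so that the affine functions
    y |-> <nu^(l), y> - kappa^(l), with kappa^(l) the penalty carried by
    eta^(l), lie below flow(z) + lambda |z - y| for every z in the support and
    every y. Here the identity [fbar + u (rhobar - rhoc(ubar))] rhoc(u) =
    fbar rhobar (price_rhoc) makes the penalty dominate the linear terms
    in mu^(l) over the box of admissible densities. Integrating the maximum of these functions
    against a coupling gives objective <= E_Q[flow] for every Q of the ball.
    The samples are arbitrary here, so that the inequality serves both parts of
    the theorem.

    Strong duality (strong_duality): since all speeds are positive, the cheapest
    way to decrease the expected flow is to shrink sample densities towards
    zero, starting with the fastest edges, until the budget eps is exhausted.
    This is a fractional knapsack (fractional_knapsack): its critical price is
    the optimal lambda, and shrinking gives an empirical measure in the ball
    whose expected flow equals the objective at eta = 0,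
    nu = min(u / T, lambda). Equality of the values and of the optimizers then
    follows by projecting (max_projection).

    For the performance guarantee, weak duality shows that the event in which
    the law lies in the ball is contained, up to a null set, in the event to be
    bounded. Comparing their probabilities requires both events to be
    measurable, and the delicate one is the ball: the Wasserstein distance to an
    empirical measure is Lipschitz in the atoms (wasserstein1_relocate), because
    a coupling can be transported along when atoms are moved, so its sublevel
    sets are obtained by countable operations from distances to rational sample
    points (measurable_wasserstein1_le). *)

(** * The 1-norm and its dual *)

Section norms.
Context {R : realType} {p q : nat}.
Implicit Types x z : 'M[R]_(p, q).

Lemma norm1_ge0 x : 0 <= norm1 x.
Proof. by apply: sumr_ge0 => i _; apply: sumr_ge0 => j _. Qed.

Lemma ler_entry_norm1 x i j : `|x i j| <= norm1 x.
Proof.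
rewrite /norm1 (bigD1 i)//= (bigD1 j)//= -addrA lerDl addr_ge0//.
  by apply: sumr_ge0.
by apply: sumr_ge0 => k _; apply: sumr_ge0.
Qed.

Lemma norm1_distC x z : norm1 (x - z) = norm1 (z - x).
Proof.
by apply: eq_bigr => i _; apply: eq_bigr => j _; rewrite !mxE distrC.
Qed.

Lemma ler_norm1D x z : norm1 (x + z) <= norm1 x + norm1 z.
Proof.
rewrite /norm1 -big_split; apply: ler_sum => i _.
by rewrite -big_split; apply: ler_sum => j _; rewrite mxE ler_normD.
Qed.

Lemma dual_norm_has_sup x :
  has_sup [set inner z x | z in [set z : 'M[R]_(p, q) | norm1 z <= 1]].
Proof.
split.
  exists (inner 0 x), 0 => //=.
  by rewrite /norm1 big1// => i _; rewrite big1// => j _; rewrite mxE normr0.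
exists (norm1 x) => _ [z /= z1 <-].
apply: ler_sum => i _; apply: ler_sum => j _.
rewrite (le_trans (ler_norm _))// normrM ler_piMl//.
exact: le_trans (ler_entry_norm1 _ _ _) z1.
Qed.

(** The dual of the 1-norm is the max norm: a signed unit matrix picks out the
    absolute value of any entry. *)
Lemma dual_normP x lam : 0 <= lam ->
  (dual_norm x <= lam) = [forall i, forall j, `|x i j| <= lam].
Proof.
move=> lam0; apply/idP/'forall_forallP => [xlam i j|xlam].
- apply: le_trans xlam; apply: ub_le_sup (dual_norm_has_sup x).2 _ _.
  exists (Num.sg (x i j) *: delta_mx i j) => /=.
  + rewrite /norm1 (bigD1 i)//= (bigD1 j)//= big1 ?big1 ?addr0.
    * by rewrite !mxE !eqxx mulr1 normr_sg; case: (_ != 0); rewrite ?lexx ?ler01.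
    * by move=> k ki; rewrite big1// => l _; rewrite !mxE (negPf ki) mulr0 normr0.
    * by move=> l lj; rewrite !mxE (negPf lj) andbF mulr0 normr0.
  + rewrite /inner (bigD1 i)//= (bigD1 j)//= big1 ?big1 ?addr0.
    * by rewrite !mxE !eqxx mulr1 normrEsg.
    * by move=> k ki; rewrite big1// => l _; rewrite !mxE (negPf ki) mulr0 mul0r.
    * by move=> l lj; rewrite !mxE (negPf lj) andbF mulr0 mul0r.
- apply: ge_sup; first exact: (dual_norm_has_sup x).1.
  move=> _ [z /= z1 <-]; apply: (@le_trans _ _ (lam * norm1 z)); last first.
    by rewrite ler_piMr.
  rewrite mulr_sumr; apply: ler_sum => i _; rewrite mulr_sumr.
  apply: ler_sum => j _; rewrite (le_trans (ler_norm _))// normrM mulrC.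
  by rewrite ler_wpM2r.
Qed.

Lemma dual_norm_ge0 x : 0 <= dual_norm x.
Proof.
apply: ub_le_sup (dual_norm_has_sup x).2 _ _; exists 0 => /=.
  by rewrite /norm1 big1// => i _; rewrite big1// => j _; rewrite mxE normr0.
by rewrite /inner big1// => i _; rewrite big1// => j _; rewrite mxE mul0r.
Qed.

Lemma ler_inner x z lam : dual_norm x <= lam -> inner x z <= lam * norm1 z.
Proof.
move=> xlam; have lam0 := le_trans (dual_norm_ge0 x) xlam.
move: xlam; rewrite dual_normP// => /'forall_forallP xlam.
rewrite mulr_sumr; apply: ler_sum => i _; rewrite mulr_sumr.
apply: ler_sum => j _; rewrite (le_trans (ler_norm _))// normrM.
by rewrite ler_wpM2r.
Qed.

Lemma innerBr z x y : inner z (x - y) = inner z x - inner z y.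
Proof.
rewrite /inner -sumrB; apply: eq_bigr => i _; rewrite -sumrB.
by apply: eq_bigr => j _; rewrite !mxE mulrBr.
Qed.

Definition mean_dist1 N (r s : N.-tuple 'M[R]_(p, q)) : R :=
  N%:R^-1 * \sum_(l < N) norm1 (r`_l - s`_l).

Lemma mean_dist1C N (r s : N.-tuple 'M[R]_(p, q)) :
  mean_dist1 r s = mean_dist1 s r.
Proof.
by congr (_ * _); apply: eq_bigr => l _; rewrite norm1_distC.
Qed.

End norms.

(** * Fractional knapsack *)

Section knapsack.
Context {R : realType} {I : finType}.
Variables (v w : I -> R) (eps : R).
Hypothesis v_gt0 : forall i, 0 < v i.
Hypothesis eps_ge0 : 0 <= eps.

Let above lam := \sum_(i | lam < v i) w i.
Let from lam := \sum_(i | lam <= v i) w i.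

(** The critical price is the smallest value whose strictly more valuable items
    fit into the budget: if the items of that value also fitted, the next
    smaller value would qualify. *)
Lemma critical_price : eps < \sum_i w i ->
  exists2 lam, 0 < lam & above lam <= eps < from lam.
Proof.
move=> w_gt.
have [i0 _] : exists i0 : I, true.
  apply/existsP; apply: contraTT w_gt => /existsPn noI.
  by rewrite big1 -?leNgt// => i; have := noI i.
have [im _ imax] := Order.TotalTheory.arg_maxP v (isT : xpredT i0).
have im_ok : above (v im) <= eps.
  rewrite /above big_pred0// => i; apply/negbTE; rewrite -leNgt.
  exact: imax.
have [il il_ok ilmin] :=
  Order.TotalTheory.arg_minP v (im_ok : (fun i => above (v i) <= eps) im).
exists (v il) => //; rewrite il_ok /= ltNge; apply/negP => from_le.
have [j0 j0_lt] : exists j, v j < v il.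
  apply/existsP; apply: contraLR w_gt => /existsPn nlt; rewrite -leNgt.
  rewrite (le_trans _ from_le)// le_eqVlt; apply/orP; left.
  by apply/eqP; apply: eq_bigl => i; rewrite leNgt nlt.
have [j j_lt jmax] :=
  Order.TotalTheory.arg_maxP v (j0_lt : (fun i => v i < v il) j0).
have : above (v j) <= eps.
  rewrite (le_trans _ from_le)// /above /from le_eqVlt; apply/orP; left.
  apply/eqP; apply: eq_bigl => i; apply/idP/idP; last exact: lt_le_trans.
  by apply: contraLR; rewrite -!ltNge -leNgt; exact: jmax.
by move/ilmin; rewrite leNgt j_lt.
Qed.

(** Linear programming duality for removing weight at most eps from items of
    unit values v: kap is the fraction kept and lam the shadow price of the
    budget. Items above the critical price go entirely, items below it stay, and
    those at the price are cut so that the budget is met exactly. *)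
Lemma fractional_knapsack : exists lam, exists kap : I -> R,
  [/\ 0 <= lam, forall i, 0 <= kap i <= 1,
      \sum_i (1 - kap i) * w i <= eps &
      \sum_i v i * (kap i * w i) =
        - (lam * eps) + \sum_i Num.min (v i) lam * w i].
Proof.
have [w_le|w_gt] := leP (\sum_i w i) eps.
  (* The budget is not binding: everything is removed at price 0. *)
  exists 0, (fun=> 0); split=> //.
  - by move=> i; rewrite lexx ler01.
  - by under eq_bigr do rewrite subr0 mul1r.
  - rewrite mul0r oppr0 add0r; apply: eq_bigr => i _.
    by rewrite min_r ?ltW// !mul0r mulr0.
have [lam lam_gt0 /andP[above_le from_gt]] := critical_price w_gt.
pose tie := \sum_(i | v i == lam) w i.
have fromE : from lam = above lam + tie.
  rewrite /from (bigID (fun i => lam < v i))/=; congr (_ + _).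
    by apply: eq_bigl => i; case: ltgtP.
  by apply: eq_bigl => i; case: ltgtP.
have tie_gt0 : 0 < tie by move: from_gt; rewrite fromE; lra.
pose th := (from lam - eps) / tie.
have th_tie : th * tie = from lam - eps by rewrite divfK ?gt_eqF.
pose kap i := if lam < v i then 0 else if v i == lam then th else 1.
exists lam, kap; split.
- exact: ltW.
- move=> i; rewrite /kap; case: ifP => _; first by rewrite lexx ler01.
  case: ifP => _; last by rewrite lexx ler01.
  apply/andP; split; first by rewrite divr_ge0 ?ltW// subr_gt0.
  by rewrite ler_pdivrMr// mul1r; move: fromE; lra.
- rewrite (_ : \sum_i _ = above lam + (1 - th) * tie); last first.
    rewrite /above /tie mulr_sumr (big_mkcond (fun i => lam < v i)).
    rewrite (big_mkcond (fun i => v i == lam)) -big_split/=.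
    by apply: eq_bigr => i _; rewrite /kap; case: ltgtP => [_|_|h] /=; rewrite ?h; ring.
  by move: fromE th_tie; lra.
- rewrite (_ : lam * eps = lam * above lam + lam * ((1 - th) * tie)); last first.
    by rewrite -mulrDr; congr (_ * _); move: fromE th_tie; lra.
  rewrite /above /tie !mulr_sumr.
  rewrite (big_mkcond (fun i => lam < v i)) (big_mkcond (fun i => v i == lam)).
  rewrite opprD -!sumrN -!big_split/=; apply: eq_bigr => i _; rewrite /kap.
  by case: ltgtP => [_|_|h] /=; rewrite ?h; ring.
Qed.

End knapsack.

(** * Measurability on matrix spaces *)

Section measurability.
Context {R : realType} {p q : nat}.
Local Notation X := 'M[R]_(p, q).

Lemma measurable_mxB d (S : measurableType d) (f g : S -> X) :
  measurable_fun setT f -> measurable_fun setT g ->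
  measurable_fun setT (fun s => f s - g s).
Proof.
move=> /measurable_mxP mf /measurable_mxP mg; apply/measurable_mxP => i j.
by under eq_fun do rewrite !mxE; exact: measurable_funB.
Qed.

Lemma measurable_norm1 d (S : measurableType d) (f : S -> X) :
  measurable_fun setT f -> measurable_fun setT (fun s => norm1 (f s)).
Proof.
move=> /measurable_mxP mf; apply: measurable_sum => i; apply: measurable_sum => j.
exact: measurableT_comp (mf i j).
Qed.

Lemma measurable_inner d (S : measurableType d) (f g : S -> X) :
  measurable_fun setT f -> measurable_fun setT g ->
  measurable_fun setT (fun s => inner (f s) (g s)).
Proof.
move=> /measurable_mxP mf /measurable_mxP mg.
apply: measurable_sum => i; apply: measurable_sum => j.
exact: measurable_funM.
Qed.

Lemma measurable_dist1 :
  measurable_fun setT (fun z : X * X => norm1 (z.1 - z.2)).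
Proof. by apply: measurable_norm1; exact: measurable_mxB. Qed.

Lemma norm1_eq0 (x : X) : norm1 x = 0 -> x = 0.
Proof.
move=> x0; apply/matrixP => i j; rewrite mxE; apply/eqP.
by rewrite -normr_le0 -x0 ler_entry_norm1.
Qed.

Lemma measurable_mx_set1 (x : X) : measurable [set x].
Proof.
rewrite (_ : [set x] = (fun y : X => norm1 (y - x)) @^-1` [set 0]).
  rewrite -[X in measurable X]setTI; apply: measurable_norm1 => //.
  exact: measurable_mxB.
apply/seteqP; split=> [y /= ->|y /= /norm1_eq0 /subr0_eq //].
by rewrite subrr /norm1 big1// => i _; rewrite big1// => j _; rewrite mxE normr0.
Qed.

End measurability.

(** * Empirical measures, couplings and the Kantorovich inequality *)

Section integration.
Local Open Scope ereal_scope.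

Lemma ge0_integral_mrestr d (T : measurableType d) (R : realType)
    (mu : {measure set T -> \bar R}) (D : set T) (mD : measurable D)
    (f : T -> \bar R) : measurable_fun setT f -> (forall x, 0 <= f x) ->
  \int[mrestr mu mD]_x f x = \int[mu]_(x in D) f x.
Proof.
move=> mf f0; have mDC := measurableC mD.
rewrite (@ge0_negligible_integral _ _ _ (mrestr mu mD) _ _ _ mDC)//; last first.
  by rewrite /= /mrestr setICl measure0.
rewrite setDE setTI setCK; apply: eq_measure_integral => A mA AD.
by rewrite /= /mrestr setIidl.
Qed.

(** pushforward carries its measure structure only together with a proof of
    measurability; bundling the two lets images be summed and rescaled. *)
Definition image_measure d1 d2 (T1 : measurableType d1) (T2 : measurableType d2)
    (R : realType) (mu : {measure set T1 -> \bar R}) (f : T1 -> T2)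
    (mf : measurable_fun setT f) : {measure set T2 -> \bar R}.
Proof. by refine [the measure _ _ of pushforward mu f]. Defined.

Lemma ge0_integral_image_measure d1 d2 (T1 : measurableType d1)
    (T2 : measurableType d2) (R : realType) (mu : {measure set T1 -> \bar R})
    (f : T1 -> T2) (mf : measurable_fun setT f) (g : T2 -> \bar R) :
  measurable_fun setT g -> (forall y, 0 <= g y) ->
  \int[image_measure mu mf]_y g y = \int[mu]_x g (f x).
Proof. by move=> mg g0; rewrite ge0_integral_pushforward. Qed.

Section uniform_points.
Context {d} {T : measurableType d} {R : realType} (N : nat) (f : nat -> T).

(** The same formula as for empirical measures, over an arbitrary measurable
    type, so that it also yields couplings of two empirical measures. *)
Definition uniform_points : set T -> \bar R :=
  mscale (N%:R^-1%:nng)%R (msum (fun l => \d_(f l)) N).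

HB.instance Definition _ := Measure.on uniform_points.

Lemma uniform_pointsE A :
  uniform_points A = (N%:R^-1 * \sum_(l < N) \1_A (f l))%R%:E.
Proof. by rewrite /uniform_points /mscale /msum EFinM -sumEFin. Qed.

Lemma integral_uniform_points (g : T -> R) :
  measurable_fun setT g -> (forall x, (0 <= g x)%R) ->
  \int[uniform_points]_x (g x)%:E = (N%:R^-1 * \sum_(l < N) g (f l))%R%:E.
Proof.
move=> /measurable_EFinP mg g0.
rewrite ge0_integral_mscale//; last by move=> *; rewrite lee_fin.
rewrite ge0_integral_measure_sum//; last by move=> *; rewrite lee_fin.
rewrite EFinM -sumEFin; congr (_ * _); apply: eq_bigr => l _.
by rewrite integral_dirac// diracT mul1e.
Qed.

Lemma uniform_pointsT : (0 < N)%N -> uniform_points setT = 1.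
Proof.
move=> N_gt0; rewrite uniform_pointsE.
under eq_bigr do rewrite indicT; rewrite sumr_const card_ord.
by rewrite mulVf// pnatr_eq0 -lt0n.
Qed.

Definition uniform_prob (N_gt0 : (0 < N)%N) : probability T R :=
  HB.pack uniform_points
    (Measure_isProbability.Build _ _ _ uniform_points (uniform_pointsT N_gt0)).

End uniform_points.

Section couplings.
Context {R : realType} {p q : nat}.
Local Notation X := 'M[R]_(p, q).
Variables (mu nu : {measure set X -> \bar R}) (pi : probability (X * X)%type R).
Hypothesis pi_coupling : couplings mu nu pi.

Lemma coupling_fst (g : X -> R) :
  measurable_fun setT g -> (forall x, (0 <= g x)%R) ->
  \int[pi]_z (g z.1)%:E = \int[mu]_x (g x)%:E.
Proof.
move=> /measurable_EFinP mg g0.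
rewrite -(ge0_integral_image_measure pi measurable_fst mg)//.
apply: eq_measure_integral => A mA _.
rewrite -(pi_coupling mA).1 /= /pushforward; congr (pi _).
by apply/seteqP; split => -[x y] //= [].
Qed.

Lemma coupling_snd (g : X -> R) :
  measurable_fun setT g -> (forall x, (0 <= g x)%R) ->
  \int[pi]_z (g z.2)%:E = \int[nu]_x (g x)%:E.
Proof.
move=> /measurable_EFinP mg g0.
rewrite -(ge0_integral_image_measure pi measurable_snd mg)//.
apply: eq_measure_integral => A mA _.
rewrite -(pi_coupling mA).2 /= /pushforward; congr (pi _).
by apply/seteqP; split => -[x y] //= [].
Qed.

Lemma coupling_ae_fst (A : set X) : measurable A -> mu A = 1 ->
  {ae pi, forall z, A z.1}.
Proof.
move=> mA muA; have mAT : measurable (A `*` setT : set (X * X)).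
  exact: measurableX.
exists (~` (A `*` setT)); split; first exact: measurableC.
  by rewrite probability_setC// (pi_coupling mA).1 muA subee.
by move=> z /= nAz [Az _]; apply: nAz.
Qed.

Lemma coupling_ae_snd (A : set X) : measurable A -> nu A = 1 ->
  {ae pi, forall z, A z.2}.
Proof.
move=> mA nuA; have mTA : measurable (setT `*` A : set (X * X)).
  exact: measurableX.
exists (~` (setT `*` A)); split; first exact: measurableC.
  by rewrite probability_setC// (pi_coupling mA).2 nuA subee.
by move=> z /= nAz [_ Az]; apply: nAz.
Qed.

End couplings.

(** The easy half of Kantorovich duality: integrate the pointwise bound against
    couplings of almost minimal cost. Such couplings exist although no optimal
    one is known, hence the slack e / (lam + 1). *)
Lemma kantorovich_le (R : realType) (p q : nat)
    (mu nu : {measure set 'M[R]_(p, q) -> \bar R}) (Z : set 'M[R]_(p, q))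
    (phi psi : 'M[R]_(p, q) -> R) (lam eps : R) :
  measurable Z -> mu Z = 1 ->
  measurable_fun setT phi -> measurable_fun setT psi ->
  (forall x, 0 <= phi x)%R -> (forall y, 0 <= psi y)%R -> (0 <= lam)%R ->
  (forall x y, Z x -> psi y <= phi x + lam * norm1 (x - y))%R ->
  wasserstein1 mu nu <= eps%:E ->
  \int[nu]_y (psi y)%:E <= \int[mu]_x (phi x)%:E + (lam * eps)%:E.
Proof.
move=> mZ muZ mphi mpsi phi0 psi0 lam0 psi_le W_le.
apply/lee_addgt0Pr => e e0.
have lam1 : (0 < lam + 1)%R by lra.
have : wasserstein1 mu nu < (eps + e / (lam + 1))%:E.
  by rewrite (le_lt_trans W_le)// lte_fin ltrDl divr_gt0.
move=> /ereal_inf_lt[_ [pi pi_coupling <-] cost_lt].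
have mdist := @measurable_dist1 R p q.
have mphi1 : measurable_fun setT (fun z : 'M[R]_(p, q) * 'M[R]_(p, q) => phi z.1).
  exact: measurableT_comp measurable_fst.
rewrite -(coupling_snd pi_coupling)// -(coupling_fst pi_coupling)//.
have le1 : \int[pi]_z (psi z.2)%:E <=
    \int[pi]_z ((phi z.1)%:E + lam%:E * (norm1 (z.1 - z.2))%:E).
  apply: ae_ge0_le_integral => //.
  - by move=> *; rewrite lee_fin.
  - by apply/measurable_EFinP; exact: measurableT_comp measurable_snd.
  - by move=> *; rewrite -EFinM -EFinD lee_fin addr_ge0// mulr_ge0// norm1_ge0.
  - apply: emeasurable_funD; first exact/measurable_EFinP.
    by apply: measurable_funeM; exact/measurable_EFinP.
  - apply: filterS (coupling_ae_fst pi_coupling mZ muZ) => z Zz _.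
    by rewrite -EFinM -EFinD lee_fin psi_le.
apply: le_trans le1 _; rewrite ge0_integralD//; first last.
- by apply: measurable_funeM; exact/measurable_EFinP.
- by move=> *; rewrite -EFinM lee_fin mulr_ge0// norm1_ge0.
- exact/measurable_EFinP.
- by move=> *; rewrite lee_fin.
rewrite ge0_integralZl//; last first.
- by move=> *; rewrite lee_fin norm1_ge0.
- exact/measurable_EFinP.
rewrite -[leRHS]addeA; apply: leeD2l; rewrite -EFinD.
apply: le_trans (lee_wpmul2l _ (ltW cost_lt)) _; first by rewrite lee_fin.
rewrite -EFinM lee_fin mulrDr lerD2l mulrCA ler_piMr//; first exact: ltW.
by rewrite ler_pdivrMr//; lra.
Qed.

End integration.

(** * Moving the atoms of an empirical measure *)

Section relocation.
Context {R : realType} {p q N : nat}.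
Local Notation X := 'M[R]_(p, q).
Variables (mu : {measure set X -> \bar R}) (r s : N.-tuple X).
Variable pi : probability (X * X)%type R.
Hypothesis pi_coupling : couplings mu (empirical r) pi.

(** Several sample points may share a location: the mass which a coupling puts
    over the location y is divided evenly among the indices l with r_l = y. *)
Definition share (l : nat) (y : X) : R :=
  (count_mem r`_l r)%:R^-1 * (y == r`_l)%:R.

Lemma share_ge0 l y : 0 <= share l y.
Proof. by rewrite mulr_ge0// invr_ge0. Qed.

Lemma measurable_share l : measurable_fun setT (share l).
Proof.
apply: measurable_funM => //.
rewrite (_ : (fun y : X => _) = \1_[set r`_l]).
  by apply: measurable_indic; exact: measurable_mx_set1.
by apply/funext => y; rewrite indicE; congr (nat_of_bool _)%:R; apply/eqP/idP;
  rewrite inE.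
Qed.

Lemma count_memE y : (count_mem y r)%:R = \sum_(k < N) (r`_k == y)%:R :> R.
Proof.
rewrite -sum1_count big_mkcond (big_nth 0) size_tuple big_mkord natr_sum.
by apply: eq_bigr => k _ /=; case: eqP.
Qed.

Lemma count_mem_neq0 (l : 'I_N) : (count_mem r`_l r)%:R != 0 :> R.
Proof.
by rewrite pnatr_eq0 -lt0n -has_count has_pred1 mem_nth// size_tuple.
Qed.

Lemma sum_share y : y \in r -> \sum_(l < N) share l y = 1.
Proof.
move=> yr; under eq_bigr => l _.
  rewrite (_ : share l y = (count_mem y r)%:R^-1 * (r`_l == y)%:R); last first.
    by rewrite /share eq_sym; case: eqP => [->//|]; rewrite !mulr0.
  over.
rewrite -mulr_sumr -count_memE mulVf// pnatr_eq0 -lt0n -has_count has_pred1.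
exact: yr.
Qed.

Lemma sum_share_atoms (c : nat -> R) :
  \sum_(k < N) \sum_(l < N) share l r`_k * c l = \sum_(l < N) c l.
Proof.
rewrite exchange_big/=; apply: eq_bigr => l _.
by rewrite -mulr_suml -mulr_sumr -count_memE mulVf ?count_mem_neq0// mul1r.
Qed.

Lemma measurable_fiber l : measurable (setT `*` [set r`_l] : set (X * X)).
Proof. by apply: measurableX => //; exact: measurable_mx_set1. Qed.

Definition redirect (l : nat) (z : X * X) : X * X := (z.1, s`_l).

Lemma measurable_redirect l : measurable_fun setT (redirect l).
Proof. exact: measurable_fun_pair. Qed.

(** The coupling obtained from pi by sending the share of index l, lying over
    r_l, to the new atom s_l, while the first coordinate stays in place. *)
Definition relocate : set (X * X)%type -> \bar R :=
  msum (fun l => mscale ((count_mem r`_l r)%:R^-1)%:nng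
    (image_measure (mrestr pi (measurable_fiber l)) (measurable_redirect l))) N.

HB.instance Definition _ := Measure.on relocate.

Lemma integral_relocate (g : X * X -> R) :
  measurable_fun setT g -> (forall z, 0 <= g z) ->
  (\int[relocate]_z (g z)%:E =
   \int[pi]_z (\sum_(l < N) share l z.2 * g (z.1, s`_l))%:E)%E.
Proof.
move=> mg g0; have mgE : measurable_fun setT (EFin \o g) by exact/measurable_EFinP.
have g0E z : (0 <= (EFin \o g) z)%E by rewrite lee_fin.
have mgl l : measurable_fun setT (fun z : X * X => g (z.1, s`_l)).
  exact: measurableT_comp (measurable_redirect l).
rewrite ge0_integral_measure_sum//; last by move=> z _; rewrite lee_fin.
under [RHS]eq_integral do rewrite -sumEFin.
rewrite ge0_integral_sum//; first last.
- by move=> l z _; rewrite lee_fin mulr_ge0// share_ge0.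
- move=> l; apply/measurable_EFinP; apply: measurable_funM => //.
  exact: measurableT_comp (measurable_share l) measurable_snd.
apply: eq_bigr => l _.
rewrite ge0_integral_mscale//; last by move=> z _; rewrite lee_fin.
rewrite [X in (_ * X)%E]ge0_integral_image_measure//.
rewrite [X in (_ * X)%E]ge0_integral_mrestr//; last first.
- by move=> z; rewrite lee_fin.
- by apply/measurable_EFinP; exact: (mgl l).
rewrite integral_mkcond -ge0_integralZl//; last first.
- by move=> z _; rewrite patchE; case: ifP => _; rewrite ?lee_fin.
- apply/(measurable_restrictT _ _).1 => //; first exact: measurable_fiber.
  by apply/measurable_EFinP; exact: measurable_funS (mgl l).
apply: eq_integral => z _; rewrite patchE /share -mulrA EFinM; congr (_ * _)%E.
case: eqP => zr; first by rewrite mem_set// mul1r.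
by rewrite memNset ?mul0r// => -[].
Qed.

Hypothesis N_gt0 : (0 < N)%N.

Lemma coupling_atoms : {ae pi, forall z, z.2 \in r}.
Proof.
apply: (coupling_ae_snd pi_coupling (A := [set` r])).
  rewrite (_ : [set` r] = \bigcup_(y in [set` r]) [set y]).
    apply: fin_bigcup_measurable => [|y _]; first exact: finite_seq.
    exact: measurable_mx_set1.
  by apply/seteqP; split=> [y yr|y [_ yr ->]//]; exists y.
rewrite [LHS](uniform_pointsE N (fun l => r`_l)).
rewrite (eq_bigr (fun=> 1)) => [|l _]; last first.
  by rewrite indicE mem_set//=; apply: mem_nth; rewrite size_tuple.
by rewrite sumr_const card_ord mulVf// pnatr_eq0 -lt0n.
Qed.

(** Each index carries total share 1 / N, whatever the multiplicities. *)
Lemma integral_share (c : nat -> R) : (forall l, 0 <= c l) ->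
  (\int[pi]_z (\sum_(l < N) share l z.2 * c l)%:E =
   (N%:R^-1 * \sum_(l < N) c l)%:E)%E.
Proof.
move=> c0.
have mh : measurable_fun setT (fun y => \sum_(l < N) share l y * c l).
  by apply: measurable_sum => l; apply: measurable_funM => //; exact: measurable_share.
have h0 y : 0 <= \sum_(l < N) share l y * c l.
  by apply: sumr_ge0 => l _; rewrite mulr_ge0// share_ge0.
rewrite (coupling_snd pi_coupling mh h0).
rewrite [LHS](integral_uniform_points N (fun l => r`_l) mh h0).
by rewrite sum_share_atoms.
Qed.

Lemma relocate_coupling A : measurable A ->
  relocate (A `*` setT) = mu A /\ relocate (setT `*` A) = empirical s A.
Proof.
move=> mA; split.
- have mC : measurable (A `*` setT : set (X * X)) by exact: measurableX.
  rewrite -[X in relocate X]setIT -integral_indic//.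
  rewrite (integral_relocate (measurable_indic mC)); last by move=> z; rewrite indicE.
  rewrite -(pi_coupling mA).1 -[X in pi X]setIT -integral_indic//.
  apply: ae_eq_integral => //.
  + apply/measurable_EFinP; apply: measurable_sum => l; apply: measurable_funM.
      exact: measurableT_comp (measurable_share l) measurable_snd.
    exact: measurableT_comp (measurable_indic mC) (measurable_redirect l).
  + by apply/measurable_EFinP; exact: measurable_indic.
  + apply: filterS coupling_atoms => z zr _; congr EFin.
    rewrite -[RHS]mul1r -(sum_share zr) mulr_suml; apply: eq_bigr => l _.
    by rewrite !indicE !in_setX !in_setT.
- have mC : measurable (setT `*` A : set (X * X)) by exact: measurableX.
  rewrite -[X in relocate X]setIT -integral_indic//.
  rewrite (integral_relocate (measurable_indic mC)); last by move=> z; rewrite indicE.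
  rewrite [RHS](uniform_pointsE N (fun l => s`_l)).
  rewrite -(@integral_share (fun l => \1_A s`_l))//.
  apply: eq_integral => z _; congr EFin; apply: eq_bigr => l _.
  by rewrite !indicE in_setX in_setT.
Qed.

Lemma relocateT : relocate setT = 1%E.
Proof.
rewrite -setXTT (relocate_coupling measurableT).1.
by rewrite -(pi_coupling measurableT).1 setXTT probability_setT.
Qed.

Definition relocate_prob : probability (X * X)%type R :=
  HB.pack relocate
    (Measure_isProbability.Build _ _ _ relocate relocateT).

(** The triangle inequality along r_l: the first coordinate travels to r_l as
    before and then from r_l to s_l. *)
Lemma relocate_cost :
  (\int[relocate]_z (norm1 (z.1 - z.2))%:E <=
   \int[pi]_z (norm1 (z.1 - z.2))%:E + (mean_dist1 r s)%:E)%E.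
Proof.
have md := @measurable_dist1 R p q.
have mshare l : measurable_fun setT (fun z : X * X => share l z.2).
  exact: measurableT_comp (measurable_share l) measurable_snd.
rewrite integral_relocate//; last by move=> z; exact: norm1_ge0.
rewrite /mean_dist1 -(@integral_share (fun l => norm1 (r`_l - s`_l))); last first.
  by move=> l; exact: norm1_ge0.
rewrite -ge0_integralD//; first last.
- by apply/measurable_EFinP; apply: measurable_sum => l; exact: measurable_funM.
- move=> z _; rewrite lee_fin; apply: sumr_ge0 => l _.
  by rewrite mulr_ge0 ?share_ge0 ?norm1_ge0.
- exact/measurable_EFinP.
- by move=> z _; rewrite lee_fin norm1_ge0.
apply: ae_ge0_le_integral => //.
- move=> z _; rewrite lee_fin; apply: sumr_ge0 => l _.
  by rewrite mulr_ge0 ?share_ge0 ?norm1_ge0.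
- apply/measurable_EFinP; apply: measurable_sum => l; apply: measurable_funM => //.
  exact: measurableT_comp md (measurable_redirect l).
- move=> z _; rewrite -EFinD lee_fin addr_ge0 ?norm1_ge0//; apply: sumr_ge0 => l _.
  by rewrite mulr_ge0 ?share_ge0 ?norm1_ge0.
- apply/measurable_EFinP; apply: measurable_funD => //.
  by apply: measurable_sum => l; exact: measurable_funM.
- apply: filterS coupling_atoms => z zr _; rewrite -EFinD lee_fin.
  rewrite -[leRHS]/(_ + _) -[norm1 (z.1 - z.2)]mul1r.
  rewrite -(sum_share zr) mulr_suml -big_split/=.
  apply: ler_sum => l _; rewrite -mulrDr /share -!mulrA.
  rewrite ler_wpM2l ?invr_ge0//; case: eqP => [->|]; last by rewrite !mul0r.
  by rewrite !mul1r (le_trans _ (ler_norm1D _ _))// subrKA.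
Qed.

End relocation.

(** * Measurability of the Wasserstein distance to an empirical measure *)

Section wasserstein_empirical.
Context {R : realType} {p q N : nat}.
Local Notation X := 'M[R]_(p, q).
Variable mu : {measure set X -> \bar R}.
Hypothesis N_gt0 : (0 < N)%N.

Lemma wasserstein1_ge0 (nu : {measure set X -> \bar R}) :
  (0 <= wasserstein1 mu nu)%E.
Proof.
apply: le_ereal_inf_tmp => _ [pi _ <-].
by apply: integral_ge0 => z _; rewrite lee_fin norm1_ge0.
Qed.

Lemma wasserstein1_relocate (r s : N.-tuple X) :
  (wasserstein1 mu (empirical s) <=
   wasserstein1 mu (empirical r) + (mean_dist1 r s)%:E)%E.
Proof.
rewrite -leeBlDr//; apply: le_ereal_inf_tmp => _ [pi pi_r <-].
rewrite leeBlDr//; apply: le_trans (relocate_cost s pi_r N_gt0).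
apply: ereal_inf_lbound.
exists (relocate_prob s pi_r N_gt0) => // A mA.
exact: (relocate_coupling s pi_r N_gt0 mA).
Qed.

End wasserstein_empirical.

Section wasserstein_measurable.
Context {R : realType} {p q N : nat}.
Local Notation X := 'M[R]_(p, q).
Variable mu : {measure set X -> \bar R}.
Hypothesis N_gt0 : (0 < N)%N.

Definition ratr_points (a : N.-tuple 'M[rat]_(p, q)) : N.-tuple X :=
  [tuple map_mx ratr (tnth a l) | l < N].

Lemma ratr_points_dense (r : N.-tuple X) (dlt : R) : 0 < dlt ->
  exists a, mean_dist1 r (ratr_points a) < dlt.
Proof.
move=> dlt0; pose e : R := dlt / (p * q).+1%:R.
have e0 : 0 < e by rewrite divr_gt0.
have /choice[f fP] (x : R) : exists a : rat, `|x - ratr a| <= e.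
  have /rat_in_itvoo[a] : x < x + e by rewrite ltrDl.
  rewrite in_itv/= => /andP[xa ae]; exists a.
  by rewrite ler_norml; apply/andP; split; lra.
exists [tuple map_mx f (tnth r l) | l < N].
have bound (l : 'I_N) :
    norm1 (r`_l - (ratr_points [tuple map_mx f (tnth r k) | k < N])`_l) <= (p * q)%:R * e.
  rewrite -!tnth_nth !tnth_mktuple.
  apply: (@le_trans _ _ (\sum_(i < p) \sum_(j < q) e)).
    by apply: ler_sum => i _; apply: ler_sum => j _; rewrite !mxE.
  by rewrite !sumr_const !card_ord -mulrnA mulnC mulr_natl.
apply: (@le_lt_trans _ _ ((p * q)%:R * e)).
  rewrite /mean_dist1 ler_pdivrMl ?ltr0n//.
  apply: le_trans (ler_sum _ (fun l _ => bound l)) _.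
  by rewrite sumr_const card_ord -[leLHS]mulr_natl.
by rewrite /e mulrA ltr_pdivrMr// mulrC ltr_pM2l// ltr_nat.
Qed.

Context {d : measure_display} {S : measurableType d}.
Variable f : S -> N.-tuple X.
Hypothesis mf : forall l, measurable_fun setT (fun x => tnth (f x) l).

Lemma measurable_mean_dist1 (s : N.-tuple X) :
  measurable_fun setT (fun x => mean_dist1 s (f x)).
Proof.
apply: measurable_funM => //; apply: measurable_sum => l.
under eq_fun do rewrite -!tnth_nth.
by apply: measurable_norm1; exact: measurable_mxB.
Qed.

(** By the Lipschitz bound, the distance at f x is below a exactly when, for some
    rational sample b close to f x, the distance at b plus the displacement
    from b to f x is; the latter depends measurably on x, and there are
    countably many b. *)
Lemma measurable_wasserstein1_lt (a : R) :
  measurable [set x | (wasserstein1 mu (empirical (f x)) < a%:E)%E].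
Proof.
pose near b := [set x | (wasserstein1 mu (empirical (ratr_points b)) +
                         (mean_dist1 (ratr_points b) (f x))%:E < a%:E)%E].
rewrite (_ : [set x | _] = \bigcup_b near b).
  apply: countable_bigcupT_measurable => [|b]; first exact: countableP.
  rewrite -[X in measurable X]setTI; apply: emeasurable_fun_infty_o => //.
  by apply: emeasurable_funD => //; apply/measurable_EFinP; exact: measurable_mean_dist1.
apply/seteqP; split=> x /=; last first.
  by move=> [b _]; apply: le_lt_trans; exact: wasserstein1_relocate.
have := wasserstein1_ge0 mu (empirical (f x)).
case E : wasserstein1 => [w| |]//= w0; rewrite lte_fin => wa.
have gap : 0 < (a - w) / 2 by rewrite divr_gt0 ?subr_gt0.
have [b bP] := ratr_points_dense (f x) gap.
exists b => //; rewrite /near/=.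
apply: le_lt_trans (leeD2r _ (wasserstein1_relocate mu N_gt0 (f x) (ratr_points b))) _.
rewrite E mean_dist1C -!EFinD lte_fin.
by rewrite mean_dist1C in bP *; lra.
Qed.

Lemma measurable_wasserstein1_le (a : R) :
  measurable [set x | (wasserstein1 mu (empirical (f x)) <= a%:E)%E].
Proof.
rewrite (_ : [set x | _] = \bigcap_k
  [set x | (wasserstein1 mu (empirical (f x)) < (a + k.+1%:R^-1)%:E)%E]).
  by apply: bigcapT_measurable => k; exact: measurable_wasserstein1_lt.
apply/seteqP; split=> x /=.
  by move=> Wa k _ /=; rewrite (le_lt_trans Wa)// lte_fin ltrDl.
move=> Wa; apply/lee_addgt0Pr => e e0.
have /ltr_add_invr[k ke] : a < a + e by rewrite ltrDl.
by apply: le_trans (ltW (Wa k I)) _; rewrite -EFinD lee_fin ltW.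
Qed.

End wasserstein_measurable.

(** * Weak duality *)

Section highway_duality.
Context {R : realType} {n m T N : nat} (hw : highway R n m).
Hypothesis hw_ok : well_posed hw.
Local Notation ubar e := (ubar hw e 0).
Local Notation rhobar e := (rhobar hw e 0).
Local Notation fbar e := (fbar hw e 0).
Local Notation X := (trajectory R n T).

Lemma admissible_gt0 u e : admissible hw u -> 0 < u e 0.
Proof. by case/(_ e) => /tnthP[k ->] _; exact: gamma_gt0. Qed.

Lemma price_gt0 e (v : R) : 0 < v ->
  0 < fbar e + v * (rhobar e - rhoc hw e (ubar e)).
Proof.
move=> v0; have := ubar_gt0 hw_ok e; have := rhobar_gt0 hw_ok e.
have := fbar_gt0 hw_ok e; have := fbar_lt hw_ok e => flt f0 r0 u0.
rewrite /rhoc /tau.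
have nz : ubar e * rhobar e - fbar e != 0 by rewrite subr_eq0 gt_eqF.
have -> : fbar e / (ubar e * rhobar e - fbar e) * rhobar e * ubar e /
    (fbar e / (ubar e * rhobar e - fbar e) * ubar e + ubar e) = fbar e / ubar e.
  field; rewrite gt_eqF//= nz/=; nra.
rewrite addr_gt0// mulr_gt0// subr_gt0 ltr_pdivrMr// mulrC//.
Qed.

(** The multiplier of eta is fbar rhobar / rhoc(u): written this way, the
    constraint becomes affine in u. *)
Lemma price_rhoc e (v : R) : 0 < v ->
  (fbar e + v * (rhobar e - rhoc hw e (ubar e))) * rhoc hw e v =
  fbar e * rhobar e.
Proof.
move=> v0; have := ubar_gt0 hw_ok e; have := rhobar_gt0 hw_ok e.
have := fbar_gt0 hw_ok e; have := fbar_lt hw_ok e => flt f0 r0 u0.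
rewrite /rhoc /tau.
have nz : ubar e * rhobar e - fbar e != 0 by rewrite subr_eq0 gt_eqF.
have d0 : 0 < ubar e * rhobar e - fbar e by rewrite subr_gt0.
by field; rewrite nz /= !gt_eqF// addr_gt0// !mulr_gt0.
Qed.

Lemma measurable_traj_support u : measurable (traj_support hw u : set X).
Proof.
rewrite (_ : traj_support hw u = \bigcap_(e in [set: 'I_n])
   \bigcap_(t in [set: 'I_T]) (fun rho : X => rho e t) @^-1` `[0, rhoc hw e (u e 0)]).
  apply: fin_bigcap_measurable => // e _; apply: fin_bigcap_measurable => // t _.
  by rewrite -[X in measurable X]setTI; exact: measurable_coord.
apply/seteqP; split=> rho /=.
  by move=> rhoP e _ t _; rewrite /= in_itv/=; exact: rhoP.
by move=> rhoP e t; have := rhoP e I t I; rewrite /= in_itv.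
Qed.

Lemma measurable_flow (u : 'cV[R]_n) : measurable_fun setT (@flow R n T u).
Proof.
apply: measurable_funM => //; apply: measurable_sum => e.
apply: measurable_sum => t; apply: measurable_funM => //; exact: measurable_coord.
Qed.

Lemma flow_ge0 u (rho : X) : admissible hw u -> traj_support hw u rho ->
  0 <= flow u rho.
Proof.
move=> uP rhoP; rewrite mulr_ge0// sumr_ge0// => e _; rewrite sumr_ge0// => t _.
by rewrite mulr_ge0 ?(ltW (admissible_gt0 _ uP))//; case/andP: (rhoP e t).
Qed.

(** The flow is nonnegative on the support but not everywhere; passing to its absolute value
    makes the theory of nonnegative integrals applicable. *)
Lemma expectation_flow u (Q : probability X R) : admissible hw u ->
  Q (traj_support hw u) = 1%E ->
  ('E_Q[flow u] = \int[Q]_rho `|flow u rho|%:E)%E.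
Proof.
move=> uP QZ; have mZ := measurable_traj_support u; have mf := measurable_flow u.
rewrite unlock; apply: ae_eq_integral => //.
- exact/measurable_EFinP.
- by apply/measurable_EFinP; exact: measurableT_comp.
- exists (~` traj_support hw u); split; first exact: measurableC.
    by have := probability_setC Q mZ; rewrite QZ subee// => <-.
  move=> rho /= nE Zrho; apply: nE => _.
  by rewrite ger0_norm// (flow_ge0 uP Zrho).
Qed.

(** Moving from y to rho costs at most lam per unit of 1-norm because
    |nu| <= lam entrywise; what remains is mu rho <= fbar rhobar eta, from
    0 <= rho <= rhoc(u) and the constraint on mu. *)
Lemma dual_term_le u (nu mu eta : X) lam (rho y : X) :
  admissible hw u -> traj_support hw u rho ->
  (forall e t, 0 <= (fbar e + u e 0 * (rhobar e - rhoc hw e (ubar e)))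
     * eta e t - mu e t) ->
  (forall e t, nu e t = mu e t + T%:R^-1 * u e 0) ->
  dual_norm nu <= lam -> (forall e t, 0 <= eta e t) ->
  inner nu y - \sum_e \sum_t fbar e * rhobar e * eta e t <=
  flow u rho + lam * norm1 (rho - y).
Proof.
move=> uP rhoP mu_le nuE nu_lam eta0.
have : inner nu (y - rho) <= lam * norm1 (rho - y).
  by rewrite norm1_distC; exact: ler_inner.
have : inner nu rho - \sum_e \sum_t fbar e * rhobar e * eta e t <= flow u rho.
  rewrite /flow /inner -sumrB mulr_sumr; apply: ler_sum => e _.
  rewrite -sumrB mulr_sumr; apply: ler_sum => t _.
  rewrite nuE -(price_rhoc e (admissible_gt0 e uP)).
  have := mu_le e t; have := price_gt0 e (admissible_gt0 e uP).
  set c := fbar e + _ => c0 mu_c; have /andP[z0 z1] := rhoP e t.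
  have h1 : mu e t * rho e t <= c * eta e t * rho e t by rewrite ler_wpM2r// -subr_ge0.
  have h2 : c * eta e t * rho e t <= c * eta e t * rhoc hw e (u e 0).
    by rewrite ler_wpM2l// mulr_ge0// ltW.
  lra.
by rewrite innerBr; lra.
Qed.

Lemma sum_exchange (F : 'I_n -> 'I_T -> 'I_N -> R) :
  \sum_e \sum_t \sum_l F e t l = \sum_l \sum_e \sum_t F e t l.
Proof.
rewrite [RHS]exchange_big; apply: eq_bigr => e _.
by rewrite [RHS]exchange_big.
Qed.

Hypothesis N_gt0 : (0 < N)%N.

(** Distinct indices may have equal sample trajectories but different
    multipliers, so the test function on the samples is a maximum over all l;
    starting it at 0 keeps it nonnegative. *)
Lemma weak_duality eps (x : samples R n T N) (p : p3_point R n T N)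
    (Q : probability X R) :
  p3_feasible hw x p -> ambiguity_ball hw eps (p3_u p) x Q ->
  ((p3_objective hw eps p)%:E <= 'E_Q[flow (p3_u p)])%E.
Proof.
case: p => -[[[[u r] lam] mu] nu] eta /= [mu_le nuE nu_lam eta0 [uP ->]] [QZ W_le].
rewrite expectation_flow//; set rho := sample_trajs hw u x.
pose kap l := \sum_e \sum_t fbar e * rhobar e * tnth eta l e t.
pose psi y := \big[Num.max/0]_(l < N) (inner (tnth nu l) y - kap l).
have lam0 : 0 <= lam.
  exact: le_trans (dual_norm_ge0 _) (nu_lam (Ordinal N_gt0)).
have mpsi : measurable_fun setT psi.
  rewrite /psi; elim: (index_enum _) => [|l s IH].
    by under eq_fun do rewrite big_nil; exact: measurable_cst.
  under eq_fun do rewrite big_cons /=.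
  apply: measurable_maxr => //; apply: measurable_funB => //.
  by apply: measurable_inner.
have psi0 y : 0 <= psi y by exact: bigmax_ge_id.
have mphi : measurable_fun setT (fun z : X => `|flow u z|).
  by apply: measurableT_comp => //; exact: measurable_flow.
have psi_le z y : traj_support hw u z -> psi y <= `|flow u z| + lam * norm1 (z - y).
  move=> zP; apply: bigmax_le => [|l _].
    by rewrite addr_ge0// mulr_ge0// norm1_ge0.
  apply: le_trans (dual_term_le y uP zP (fun e t => mu_le e t l)
    (fun e t => nuE e t l) (nu_lam l) (fun e t => eta0 e t l)) _.
  exact: lerD (ler_norm _) (lexx _).
have := kantorovich_le (measurable_traj_support u) QZ mphi mpsi
  (fun z => normr_ge0 _) psi0 lam0 psi_le W_le.
rewrite [X in (X <= _)%E](integral_uniform_points N (fun l => rho`_l) mpsi psi0).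
rewrite -leeBlDr//; apply: le_trans; rewrite -EFinB lee_fin.
rewrite sum_exchange -[X in X <= _]addrA [X in _ <= X]addrC mulNr lerD2l.
rewrite addrC -mulrBr ler_wpM2l// -sumrB; apply: ler_sum => l _.
rewrite [tnth rho l](tnth_nth 0).
exact: (le_bigmax 0 (fun k => inner (tnth nu k) rho`_l - kap k) l).
Qed.

End highway_duality.

(** * Strong duality *)

Section strong.
Context {R : realType} {n m T N : nat} (hw : highway R n m).
Hypothesis hw_ok : well_posed hw.
Hypotheses (T_gt0 : (0 < T)%N) (N_gt0 : (0 < N)%N).
Local Notation X := (trajectory R n T).

(** The coupling which sends the l-th point to the l-th point. *)
Lemma wasserstein1_uniform (r s : N.-tuple X) :
  (wasserstein1 (uniform_prob (fun l => s`_l) N_gt0) (empirical r) <=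
   (mean_dist1 s r)%:E)%E.
Proof.
apply: ge_ereal_inf.
exists (\int[uniform_prob (fun l => (s`_l, r`_l)) N_gt0]_z (norm1 (z.1 - z.2))%:E)%E.
  exists (uniform_prob (fun l => (s`_l, r`_l)) N_gt0) => // A mA; split.
  - rewrite [LHS]uniform_pointsE [RHS]uniform_pointsE; congr (_ * _)%:E.
    by apply: eq_bigr => l _; rewrite !indicE in_setX in_setT andbT.
  - rewrite [LHS]uniform_pointsE [RHS](uniform_pointsE N (fun l => r`_l)).
    congr (_ * _)%:E.
    by apply: eq_bigr => l _; rewrite !indicE in_setX in_setT.
rewrite [X in (X <= _)%E]integral_uniform_points//; first exact: measurable_dist1.
by move=> z; exact: norm1_ge0.
Qed.

(** The worst-case law scales the densities of edge e in every sample by the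
    knapsack fraction kap e. The upper bounds of the support never bind, as
    decreasing densities is what decreases the flow, and so eta = 0. *)
Lemma strong_duality eps (x : samples R n T N) u : 0 <= eps ->
  admissible hw u -> (forall l, traj_support hw u (traj hw u (tnth x l))) ->
  exists p : p3_point R n T N, [/\ p3_feasible hw x p, p3_u p = u &
    (certificate hw eps x u <= (p3_objective hw eps p)%:E)%E].
Proof.
move=> eps0 uP xP; pose r := sample_trajs hw u x.
have rE (l : 'I_N) : r`_l = traj hw u (tnth x l) by rewrite -tnth_nth tnth_mktuple.
(* Unit value and total weight of edge e in the knapsack. *)
pose v e := T%:R^-1 * u e 0.
pose w e := N%:R^-1 * \sum_(l < N) \sum_t r`_l e t.
have v0 e : 0 < v e by rewrite mulr_gt0 ?invr_gt0 ?ltr0n// (admissible_gt0 hw_ok).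
have r0 (l : 'I_N) e t : 0 <= r`_l e t <= rhoc hw e (u e 0) by rewrite rE; exact: xP.
have [lam [kap [lam0 kap01 budget gain]]] :=
  @fractional_knapsack R 'I_n v w eps v0 eps0.
pose s : N.-tuple X := [tuple \matrix_(e, t) (kap e * r`_l e t) | l < N].
have sE (l : 'I_N) : s`_l = \matrix_(e, t) (kap e * r`_l e t).
  by rewrite -tnth_nth tnth_mktuple.
have average (c : 'I_n -> R) :
    N%:R^-1 * \sum_(l < N) \sum_e \sum_t c e * r`_l e t = \sum_e c e * w e.
  rewrite exchange_big mulr_sumr; apply: eq_bigr => e _; rewrite /w mulrCA.
  congr (_ * _); rewrite mulr_sumr; apply: eq_bigr => l _.
  by rewrite mulr_sumr.
have sP (l : 'I_N) : traj_support hw u s`_l.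
  move=> e t; rewrite sE mxE; have /andP[k0 k1] := kap01 e.
  have /andP[r1 r2] := r0 l e t; rewrite mulr_ge0//=.
  by apply: le_trans r2; rewrite ler_piMl.
pose Q : probability X R := uniform_prob (fun l => s`_l) N_gt0.
have QZ : Q (traj_support hw u) = 1%E.
  rewrite [LHS]uniform_pointsE (eq_bigr (fun=> 1)) => [|l _]; last first.
    by rewrite indicE mem_set.
  by rewrite sumr_const card_ord mulVf// pnatr_eq0 -lt0n.
have Q_ball : ambiguity_ball hw eps u x Q.
  split=> //; apply: le_trans (wasserstein1_uniform _ _) _; rewrite lee_fin.
  apply: le_trans budget; rewrite -average le_eqVlt; apply/orP; left; apply/eqP.
  congr (_ * _); apply: eq_bigr => l _; rewrite sE.
  apply: eq_bigr => e _; apply: eq_bigr => t _; rewrite !mxE.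
  have /andP[k0 k1] := kap01 e; have /andP[r1 r2] := r0 l e t.
  rewrite distrC ger0_norm; last by rewrite subr_ge0 ler_piMl.
  by rewrite mulrBl mul1r.
pose nu : N.-tuple X := [tuple \matrix_(e, t) Num.min (v e) lam | l < N].
pose mu : N.-tuple X := [tuple \matrix_(e, t) (Num.min (v e) lam - v e) | l < N].
pose eta : N.-tuple X := [tuple 0 | l < N].
exists (u, r, lam, mu, nu, eta); split=> //=.
- split=> // [e t l|e t l|l|e t l]; rewrite ?tnth_mktuple ?mxE//.
  + by rewrite mulr0 sub0r opprB subr_ge0 ge_min lexx.
  + by rewrite subrK.
  + rewrite dual_normP//; apply/'forall_forallP => e t; rewrite mxE.
    have min0 : 0 <= Num.min (v e) lam by rewrite le_min lam0 ltW.
    by rewrite ger0_norm// ge_min lexx orbT.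
- apply: le_trans (ereal_inf_lbound _) _; first by exists Q.
  rewrite (expectation_flow hw_ok uP QZ).
  have mf : measurable_fun setT (fun z : X => `|flow u z|).
    by apply: measurableT_comp => //; exact: measurable_flow.
  rewrite [X in (X <= _)%E](integral_uniform_points N (fun l => s`_l) mf)//.
  rewrite lee_fin.
  rewrite (eq_bigr (fun l : 'I_N =>
    \sum_e \sum_t (v e * kap e) * r`_l e t)); last first.
    move=> l _; rewrite ger0_norm ?(flow_ge0 hw_ok uP)//.
    rewrite /flow mulr_sumr; apply: eq_bigr => e _; rewrite mulr_sumr.
    by apply: eq_bigr => t _; rewrite sE mxE /v; ring.
  rewrite average.
  rewrite (eq_bigr (fun e => v e * (kap e * w e))) => [|e _]; last exact/esym/mulrA.
  rewrite gain (_ : \sum_e \sum_t \sum_l _ = 0) ?mulr0 ?subr0; last first.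
    rewrite big1// => e _; rewrite big1// => t _; rewrite big1// => l _.
    by rewrite tnth_mktuple mxE mulr0.
  rewrite mulNr lerD2l -average le_eqVlt; apply/orP; left; apply/eqP.
  congr (_ * _); apply: eq_bigr => l _; apply: eq_bigr => e _; apply: eq_bigr => t _.
  by rewrite (tnth_nth 0 r) tnth_mktuple mxE.
Qed.

End strong.

(** * Equivalence of the two problems and performance guarantee *)

(** Equality of suprema alone does not transfer optimizers; what does is that
    each value f u is attained by f' on the fibre of h over u. *)
Lemma max_projection {R : realType} {A B : Type} (S : set A) (S' : set B)
    (f : A -> \bar R) (f' : B -> \bar R) (h : B -> A) :
  (forall p, S' p -> S (h p) /\ (f' p <= f (h p))%E) ->
  (forall u, S u -> exists p, [/\ S' p, h p = u & (f u <= f' p)%E]) ->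
  max_value S f = max_value S' f' /\ maximizers S f = h @` maximizers S' f'.
Proof.
move=> below attained; split.
- apply/eqP; rewrite eq_le; apply/andP; split; apply: ge_ereal_sup.
  + move=> _ [u /attained[p [S'p _ up]] <-]; apply: le_trans up _.
    by apply: ereal_sup_ubound; exists p.
  + move=> _ [p /below[Shp hp] <-]; apply: le_trans hp _.
    by apply: ereal_sup_ubound; exists (h p).
- apply/seteqP; split=> [u [Su umax]|_ [p [S'p pmax] <-]].
  + have [p [S'p hp up]] := attained u Su; exists p => //; split=> // q /below[Shq hq].
    exact: le_trans hq (le_trans (umax _ Shq) up).
  + have [Shp hp] := below p S'p; split=> // v /attained[q [S'q _ vq]].
    exact: le_trans vq (le_trans (pmax _ S'q) hp).
Qed.

Section measurable_events.
Context {R : realType} {n m T N : nat} (hw : highway R n m).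
Hypothesis N_gt0 : (0 < N)%N.

Lemma measurable_ambiguity_event eps u (Q : probability (trajectory R n T) R) :
  measurable [set x : samples R n T N | ambiguity_ball hw eps u x Q].
Proof.
have [QZ|nQZ] := pselect (Q (traj_support hw u) = 1%E); last first.
  by rewrite (_ : [set x | _] = set0)//; apply/seteqP; split=> x // [].
rewrite (_ : [set x | _] = [set x : samples R n T N |
  (wasserstein1 Q (empirical (sample_trajs hw u x)) <= eps%:E)%E]); last first.
  by apply/seteqP; split=> x //= [].
apply: measurable_wasserstein1_le => // l.
under eq_fun do rewrite tnth_mktuple.
exact: measurableT_comp (measurable_traj hw u) (measurable_tnth l).
Qed.

Lemma measurable_p3_objective eps (p : samples R n T N -> p3_point R n T N) :
  measurable_fun setT p ->
  measurable_fun setT (fun x => p3_objective hw eps (p x)).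
Proof.
move=> mp.
have mobj : measurable_fun setT (p3_objective hw eps : p3_point R n T N -> R).
  rewrite (_ : p3_objective hw eps = fun q : p3_point R n T N =>
    - q.1.1.1.2 * eps
    - N%:R^-1 * (\sum_e \sum_t \sum_l fbar hw e 0 * rhobar hw e 0 * tnth q.2 l e t)
    + N%:R^-1 * \sum_l inner (tnth q.1.2 l) (tnth q.1.1.1.1.2 l)); last first.
    by apply/funext => -[[[[[u r] lam] mu] nu] eta].
  have m1 : measurable_fun setT (fun q : p3_point R n T N => q.1).
    exact: measurable_fst.
  have m11 : measurable_fun setT (fun q : p3_point R n T N => q.1.1).
    exact: measurableT_comp measurable_fst m1.
  have m111 : measurable_fun setT (fun q : p3_point R n T N => q.1.1.1).
    exact: measurableT_comp measurable_fst m11.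
  have mtup (g : p3_point R n T N -> N.-tuple (trajectory R n T)) l :
      measurable_fun setT g -> measurable_fun setT (fun q => tnth (g q) l).
    by move=> mg; exact: measurableT_comp (measurable_tnth l) mg.
  apply: measurable_funD; first apply: measurable_funB.
  - apply: measurable_funM => //; apply: measurableT_comp => //.
    exact: measurableT_comp measurable_snd m111.
  - apply: measurable_funM => //; apply: measurable_sum => e.
    apply: measurable_sum => t; apply: measurable_sum => l.
    apply: measurable_funM => //.
    by apply: measurableT_comp (measurable_coord e t) _; exact: mtup.
  - apply: measurable_funM => //; apply: measurable_sum => l.
    apply: measurable_inner; apply: mtup.
      exact: measurableT_comp measurable_snd m1.
    apply: measurableT_comp measurable_snd _.
    exact: measurableT_comp measurable_fst m111.
exact: measurableT_comp mobj mp.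
Qed.

End measurable_events.
Theorem mainTheorem3 (R : realType) (n m T N : nat) (hw : highway R n m)
    (beta eps : R)
    (Pw : probability (uncertainty R n T) R)
    (PN : probability (samples R n T N) R)
    (T_gt0 : (0 < T)%N) (N_gt0 : (0 < N)%N)
    (hw_ok : well_posed hw)
    (beta01 : 0 < beta < 1) (eps_gt0 : 0 < eps)
    (Pw_light : light_tailed Pw)
    (PN_iid : iid_law Pw PN)
    (Pw_supp : forall u, admissible hw u ->
       traj_law hw Pw u (traj_support hw u) = 1%E)
    (eps_radius : forall u, admissible hw u ->
       ((1 - beta)%:E <=
         PN [set x | ambiguity_ball hw eps u x (traj_law hw Pw u)])%E) :
  (forall x : samples R n T N,
     (forall u, admissible hw u ->
        forall l, traj_support hw u (traj hw u (tnth x l))) ->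
     let J := certificate hw eps x in
     let Jhat := fun p => (p3_objective hw eps p)%:E in
     max_value (admissible hw) J = max_value (p3_feasible hw x) Jhat /\
     maximizers (admissible hw) J =
       @p3_u _ _ _ _ @` maximizers (p3_feasible hw x) Jhat)
  /\
  (forall u, admissible hw u ->
     forall p : samples R n T N -> p3_point R n T N,
       measurable_fun setT p ->
       (forall x, p3_u (p x) = u) ->
       {ae PN, forall x, p3_feasible hw x (p x)} ->
       ((1 - beta)%:E <=
         PN [set x | ((p3_objective hw eps (p x))%:E <=
                       'E_(traj_law hw Pw u)[flow u])%E])%E).
Proof.
split=> [x xP J Jhat|u uP p mp pu pfeas].
  apply: max_projection => [p pP|u uP].
  - split.
      by case: p pP => -[[[[u r] lam] mu] nu] eta [_ _ _ _ []].
    apply: le_ereal_inf_tmp => _ [Q Q_ball <-].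
    exact: (weak_duality hw_ok N_gt0 pP Q_ball).
  - exact: (strong_duality hw_ok T_gt0 N_gt0 (ltW eps_gt0) uP (xP u uP)).
(* B is the event whose probability eps_radius bounds; outside the null set Z
   the point p x is feasible, and there B implies the event C. *)
pose B := [set x : samples R n T N | ambiguity_ball hw eps u x (traj_law hw Pw u)].
set C := [set x | _ <= 'E_(traj_law hw Pw u)[flow u]]%E.
have mB : measurable B by exact: measurable_ambiguity_event.
have mC : measurable C.
  rewrite -[X in measurable X]setTI; apply: emeasurable_fun_infty_c => //.
  by apply/measurable_EFinP; exact: measurable_p3_objective.
have [Z [mZ PZ0 nfeasZ]] := pfeas.
apply: le_trans (eps_radius u uP) _; rewrite -(measureU0 mC mZ PZ0).
apply: le_measure; rewrite ?inE//; first exact: measurableU.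
move=> x Bx; have [feas|nfeas] := pselect (p3_feasible hw x (p x)); last first.
  by right; exact: nfeasZ.
by left; rewrite /C/= -(pu x); apply: (weak_duality hw_ok N_gt0 feas); rewrite pu.
Qed.
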